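(* For every temporal graph $\mathcal{G}=(V,E)$, all $s,z\in V$ and all $x,\delta\in\mathbb{N}$, the instance $(\mathcal{G},s,z,x,\delta)$ is a yes-instance of Traversal-Delay-Robust Path if and only if it is a yes-instance of Starting-Delay-Robust Path.
   Context: A temporal graph $\mathcal{G}=(V,E)$ consists of a finite vertex set $V$ and a finite set $E$ of time arcs $e=(v,w,t,\lambda)$ with start vertex $v$, end vertex $w$, time label $t\in\mathbb{N}$ and traversal time $\lambda\in\mathbb{N}$. A temporal walk is a sequence of time arcs $(v_i,w_i,t_i,\lambda_i)_{i=1}^{\ell}$ with $v_{i+1}=w_i$ and $t_{i+1}\ge t_i+\lambda_i$ for all $i<\ell$. For $D\subseteq E$ and $\delta\in\mathbb{N}$: a starting delay on an arc increases its time label by $\delta$; a traversal delay increases its traversal time by $\delta$. A sequence of time arcs is a $D$-starting-delayed (resp. $D$-traversal-delayed) temporal walk if it is a temporal walk in the temporal graph obtained from $\mathcal{G}$ by applying starting (resp. traversal) delays to all arcs of $D$. A route is a sequence of vertices $R$; a (delayed) temporal walk follows $R$ if the vertices it visits ($v_1,w_1,\dots,w_\ell$) are exactly $R$ in order; $R$ is a $D$-delayed route if a $D$-delayed temporal walk follows it. An $(s,z)$-route starts at $s$ and ends at $z$. A route is $x$-traversal-delay-robust (resp. $x$-starting-delay-robust) if it is a $D$-traversal-delayed (resp. $D$-starting-delayed) route for all $D\subseteq E$ with $|D|\le x$. Traversal-Delay-Robust Path (resp. Starting-Delay-Robust Path): given $(\mathcal{G},s,z,x,\delta)$, decide whether there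 is an $x$-traversal-delay-robust (resp. $x$-starting-delay-robust) $(s,z)$-route in $\mathcal{G}$. *)

(* Defs.v *)
From mathcomp Require Import all_boot finmap.

Set Implicit Arguments.
Unset Strict Implicit.
Unset Printing Implicit Defensive.

Local Open Scope fset_scope.
Local Open Scope nat_scope.

(* (v, w, t, l) : start vertex, end vertex, time label, traversal time. *)
Definition time_arc (V : finType) : choiceType := (V * V * nat * nat)%type.

Definition arc_start (V : finType) (e : time_arc V) : V := e.1.1.1.
Definition arc_end (V : finType) (e : time_arc V) : V := e.1.1.2.
Definition time_label (V : finType) (e : time_arc V) : nat := e.1.2.
Definition traversal_time (V : finType) (e : time_arc V) : nat := e.2.

(* A temporal graph with vertex set V is given by its finite set of time arcs;
   parallel arcs and self-loops are allowed, and labels and traversal times may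
   be 0. *)
Definition temporal_graph (V : finType) : choiceType := {fset time_arc V}.

Definition consecutive (V : finType) (e f : time_arc V) : bool :=
  (arc_start f == arc_end e) && (time_label e + traversal_time e <= time_label f).

Definition temporal_walk (V : finType) (G : temporal_graph V)
    (p : seq (time_arc V)) : bool :=
  all (fun e => e \in G) p && sorted (@consecutive V) p.

Definition starting_delay (V : finType) (delta : nat) (e : time_arc V) :
    time_arc V :=
  (arc_start e, arc_end e, time_label e + delta, traversal_time e).

Definition traversal_delay (V : finType) (delta : nat) (e : time_arc V) :
    time_arc V :=
  (arc_start e, arc_end e, time_label e, traversal_time e + delta).

Definition delayed_graph (V : finType) (delay : time_arc V -> time_arc V)
    (D : {fset time_arc V}) (G : temporal_graph V) : temporal_graph V :=
  [fset (if e \in D then delay e else e) | e in G].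

(* v_1, w_1, ..., w_l. The empty walk visits no vertex, so it does not follow
   a one-vertex route. *)
Definition visited (V : finType) (p : seq (time_arc V)) : seq V :=
  if p is e :: _ then arc_start e :: [seq arc_end f | f <- p] else [::].

Definition delayed_route (V : finType) (delay : time_arc V -> time_arc V)
    (G : temporal_graph V) (D : {fset time_arc V}) (R : seq V) : Prop :=
  exists p : seq (time_arc V),
    temporal_walk (delayed_graph delay D G) p /\ visited p = R.

Definition delay_robust (V : finType) (delay : time_arc V -> time_arc V)
    (G : temporal_graph V) (x : nat) (R : seq V) : Prop :=
  forall D : {fset time_arc V},
    D `<=` G -> #|` D| <= x -> delayed_route delay G D R.

Definition sz_route (V : finType) (s z : V) (R : seq V) : bool :=
  if R is v :: R' then (v == s) && (last v R' == z) else false.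

Definition Traversal_Delay_Robust_Path (V : finType) (G : temporal_graph V)
    (s z : V) (x delta : nat) : Prop :=
  exists R : seq V,
    sz_route s z R /\ delay_robust (@traversal_delay V delta) G x R.

Definition Starting_Delay_Robust_Path (V : finType) (G : temporal_graph V)
    (s z : V) (x delta : nat) : Prop :=
  exists R : seq V,
    sz_route s z R /\ delay_robust (@starting_delay V delta) G x R.

(* Main.v *)
(** A traversal-delayed walk stays a walk when its delays become starting
    delays: the arrival times agree and the departures are only later.  For
    the converse, cutting closed detours makes the start vertices of the steps
    of the route distinct, so that each arc can serve only one step.  Given a
    set [D] of traversal delays, let the starting-delay adversary delay only
    those arcs of [D] whose label is at least the earliest arrival (under the
    traversal delays) at their start vertex.  Step by step, a starting-delayed
    walk then arrives no earlier than the greedy traversal-delayed one, so if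
    the former exists, the latter does not get stuck. *)

Require Import Defs.
From mathcomp Require Import all_boot finmap.

Set Implicit Arguments.
Unset Strict Implicit.
Unset Printing Implicit Defensive.

Local Open Scope fset_scope.
Local Open Scope nat_scope.

Section Routes.

Variable V : finType.
Implicit Types (H G : temporal_graph V) (D : {fset time_arc V}).
Implicit Types (v w : V) (R : seq V) (e f : time_arc V).

Definition arrival e := time_label e + traversal_time e.

(** [R] lists the vertices after [v], which can be left from time [a] on. The base case is true
    although no walk follows a one-vertex route, hence the conditions [R != [::]] below. *)
Fixpoint followable H (a : nat) v R : Prop :=
  if R is w :: R' then
    exists e, [/\ e \in H, arc_start e = v, arc_end e = w, a <= time_label e
                & followable H (arrival e) w R']
  else True.

Lemma followableW H a b v R : b <= a -> followable H a v R -> followable H b v R.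
Proof.
case: R => [//|w R] ba [e [eH ev ew ae fe]].
by exists e; split=> //; apply: leq_trans ae.
Qed.

Lemma followable_cat H a v R1 w R2 :
  followable H a v (R1 ++ w :: R2) -> exists2 b, a <= b & followable H b w R2.
Proof.
elim: R1 a v => [|u R1 IH] a v /= [e [_ _ _ ae fe]].
  by exists (arrival e) => //; apply: leq_trans ae (leq_addr _ _).
have [b eb fb] := IH _ _ fe; exists b => //.
by apply: leq_trans eb; apply: leq_trans ae (leq_addr _ _).
Qed.

Lemma sub_followable H1 H2 a v R :
    {in H1, forall e, arc_start e \in belast v R -> e \in H2} ->
  followable H1 a v R -> followable H2 a v R.
Proof.
elim: R a v => [//|w R IH] a v /= sub [e [eH ev ew ae fe]].
exists e; split=> //; first by apply: sub => //; rewrite ev mem_head.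
by apply: IH fe => f fH fR; apply: sub => //; rewrite inE fR orbT.
Qed.

Lemma walk_followable H e p :
    all (fun f => f \in H) p -> path (@consecutive V) e p ->
  followable H (arrival e) (arc_end e) [seq arc_end f | f <- p].
Proof.
elim: p e => [//|f p IH] e /= /andP[fH pH] /andP[/andP[/eqP fe ef] fp].
by exists f; split=> //; apply: IH.
Qed.

Lemma followable_walk H a v R : followable H a v R -> R != [::] ->
  exists e p, [/\ temporal_walk H (e :: p), visited (e :: p) = v :: R
                & a <= time_label e].
Proof.
elim: R a v => [//|w [|u R] IH] a v /= [e [eH ev ew ae fe]] _.
  by exists e, [::]; rewrite /temporal_walk /= eH ev ew.
have [f [p [/andP[/= /andP[fH pH] fp] [fw fu fR] ef]]] := IH _ _ fe isT.
exists e, (f :: p); split=> //.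
  by rewrite /temporal_walk /= eH fH pH fp /consecutive fw ew eqxx -[_ + _]/(arrival e) ef.
by rewrite /= ev ew fu fR.
Qed.

Lemma delayed_routeP delay G D v R :
  delayed_route delay G D (v :: R) <->
  R != [::] /\ followable (delayed_graph delay D G) 0 v R.
Proof.
split=> [[[|e p] [pW //= [ev eR]]] | [R0 fR]].
  case/andP: pW => /= /andP[eH pH] ep.
  rewrite -eR; split=> //=; exists e; split=> //.
  exact: walk_followable.
by have [e [p [ep vp _]]] := followable_walk fR R0; exists (e :: p).
Qed.

Lemma in_delayed_graph delay D G e :
  e \in G -> (if e \in D then delay e else e) \in delayed_graph delay D G.
Proof.
by move=> eG; apply/imfsetP; exists e.
Qed.

(** Skipping a closed detour only leaves more time to depart. [R'] depends on the route alone, so it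
    serves all delayed graphs at once. The last vertex may recur, since a closed route must keep at
    least one arc. *)
Lemma cut_detours v R : R != [::] ->
  exists R', [/\ R' != [::], last v R' = last v R, uniq (belast v R')
    & forall H a, followable H a v R -> followable H a v R'].
Proof.
elim: R v => [//|w [|u R] IH] v _; first by exists [:: w].
have [R' [R'0 lR' uR' fR']] := IH w isT.
have fvR' H a : followable H a v [:: w, u & R] -> followable H a v (w :: R').
  by case=> e [eH ev ew ae /fR' fe]; exists e.
have [vR'|vR'] := boolP (v \in belast w R'); last first.
  by exists (w :: R'); split; rewrite //= vR'.
have eR' := lastI w R'; move: uR' eR'; case/splitPr: vR' => p q.
rewrite cat_uniq => /and3P[_ _ uq]; rewrite rcons_cat rcons_cons => eR'.
(* The route resumes at the later visit to [v]. *)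
exists (rcons q (last w R')); split.
- by case: (q).
- by rewrite last_rcons lR'.
- by rewrite belast_rcons.
- move=> H a /fvR'; rewrite eR' => /followable_cat[b ab].
  exact: followableW.
Qed.

Variable delta : nat.

Local Notation trav D G := (delayed_graph (traversal_delay delta) D G).
Local Notation start D G := (delayed_graph (starting_delay delta) D G).

Lemma traversal_followable_starting D G a v R :
  followable (trav D G) a v R -> followable (start D G) a v R.
Proof.
elim: R a v => [//|w R IH] a v /= [_ [/imfsetP[/= e eG ->] ev ew ae fe]].
exists (if e \in D then starting_delay delta e else e).
split; first exact: in_delayed_graph.
all: case: ifP ev ew ae fe => //= _ _ _ ae fe.
- exact: leq_trans ae (leq_addr _ _).
- by apply: IH; move: fe; rewrite /arrival /= addnA addnAC.
- exact: IH.
Qed.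

(** [D'] is built along the route, before any walk is known. The clause on start vertices keeps the
    delays chosen for later steps off the arcs leaving [v]. *)
Lemma starting_followable_traversal D G a v R : uniq (belast v R) ->
  exists D', [/\ D' `<=` D, {in D', forall e, arc_start e \in belast v R}
    & followable (start D' G) a v R -> followable (trav D G) a v R].
Proof.
elim: R a v => [|w R IH] a v /=; first by exists fset0; split; rewrite ?fsub0set.
case/andP=> vR uR.
pose fits e := [&& arc_start e == v, arc_end e == w & a <= time_label e].
pose reached b := has (fun e => fits e && (arrival e == b)) (trav D G).
have [/hasP[e0 e0H fe0]|none] := boolP (has fits (trav D G)); last first.
  (* Traversal delays keep labels, so an undelayed first arc would also fit in [trav D G]. *)
  exists fset0; split; rewrite ?fsub0set // => -[_ [/imfsetP[/= e eG ->]]].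
  move=> ev ew ae _; case/hasP: none.
  exists (if e \in D then traversal_delay delta e else e).
    exact: in_delayed_graph.
  by rewrite /fits; case: ifP => _; rewrite /= -ev -ew !eqxx.
have ex_reached : exists b, reached b.
  by exists (arrival e0); apply/hasP; exists e0; rewrite ?fe0 ?eqxx.
case: (ex_minnP ex_reached) => b /hasP[e eH /andP[/and3P[/eqP ev /eqP ew ae]]].
move=> /eqP eb bmin.
have [D'' [D''D D''R D''f]] := IH b w uR.
(* Arcs of [D] with label below [a] are already missed; a starting delay could make them
   catchable. *)
exists (D'' `|` [fset f in D | (arc_start f == v) && (a <= time_label f)]).
set D' := _ `|` _.
have inD' f : f \in D' =
    (f \in D'') || [&& f \in D, arc_start f == v & a <= time_label f].
  by rewrite /D' in_fsetU !inE.
split.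
- apply/fsubsetP=> f; rewrite inD' => /orP[|/and3P[]//].
  exact: (fsubsetP D''D).
- move=> f; rewrite inD' inE => /orP[/D''R ->|/and3P[_ -> _]//].
  by rewrite orbT.
case=> _ [/imfsetP[/= f fG ->] fv fw af ff].
exists e; split=> //; rewrite eb; apply: D''f.
have {}fv : arc_start f = v by move: fv; case: ifP.
have {}fw : arc_end f = w by move: fw; case: ifP.
have fD'' : f \notin D'' by apply: contra vR => /D''R; rewrite fv.
have fa : a <= time_label f.
  move: af; case: ifP => //; rewrite inD' (negPf fD'').
  by case/and3P.
(* Both kinds of delay give [f] the same arrival, so the minimality of [b] applies. *)
have bf : b <= arrival (if f \in D' then starting_delay delta f else f).
  apply: bmin; apply/hasP.
  exists (if f \in D then traversal_delay delta f else f).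
    exact: in_delayed_graph.
  rewrite inD' (negPf fD'') fv eqxx fa andbT /=.
  case: ifP => _; apply/andP; split=> //; try by apply/and3P; split=> //; apply/eqP.
  by rewrite /arrival /= addnA addnAC.
(* The remaining steps never leave from [v], so [D'] and [D''] delay their arcs alike. *)
apply: followableW bf _; apply: sub_followable ff => _ /imfsetP[/= g gG ->] gR.
have gv : arc_start g != v.
  by apply: contraNneq vR => <-; move: gR; case: ifP.
by rewrite inD' (negPf gv) andbF orbF; apply: in_delayed_graph.
Qed.

End Routes.

Theorem theorem4 (V : finType) (G : temporal_graph V) (s z : V) (x delta : nat) :
  Traversal_Delay_Robust_Path G s z x delta <->
  Starting_Delay_Robust_Path G s z x delta.
Proof.
split=> -[[|v R] [//= /andP[/eqP -> /eqP Rz] robR]].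
  exists (s :: R); split=> [|D DG Dx]; first by rewrite /= Rz !eqxx.
  have /delayed_routeP[R0 fR] := robR D DG Dx.
  by apply/delayed_routeP; split=> //; apply: traversal_followable_starting.
have /delayed_routeP[R0 _] := robR fset0 (fsub0set _) (leq0n _).
have [R' [R'0 lR' uR' cutR]] := cut_detours s R0.
exists (s :: R'); split=> [|D DG Dx].
  by rewrite /= eqxx lR' Rz eqxx.
have [D' [D'D _ D'f]] := starting_followable_traversal delta D G 0 uR'.
(* Robustness is applied to the uncut route; the cut then happens inside the graph delayed by
   [D']. *)
have /delayed_routeP[_ fR] : delayed_route (starting_delay delta) G D' (s :: R).
  apply: robR; first exact: fsubset_trans DG.
  exact: leq_trans (fsubset_leq_card D'D) Dx.
by apply/delayed_routeP; split=> //; apply/D'f/cutR.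
Qed.
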